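(* Let $(X,(p_j)_{j\ge 1})$ be a Fréchet space without continuous norm. If there exists $j_0\ge 1$ such that for every $j\ge j_0$, $\ker p_{j+1}$ is a subspace of finite codimension in $\ker p_j$, then $X$ satisfies the Invariant Subspace Property.
   Context: A Fréchet space $(X,(p_j)_{j\ge1})$ (over $\mathbb{K}=\mathbb{R}$ or $\mathbb{C}$) is a topological vector space whose topology is induced by a non-decreasing and separating sequence of seminorms $(p_j)_{j\ge 1}$ such that the metric $d(x,y)=\sum_{j\ge 1}2^{-j}\min\{1,p_j(x-y)\}$ is complete; the sequence $(p_j)$ is always assumed non-decreasing and separating. ''Without continuous norm'' means that no norm on $X$ is continuous for the topology of $X$. $L(X)$ denotes the set of continuous linear operators $T:X\to X$. An operator $T\in L(X)$ possesses a non-trivial invariant subspace if there exists a closed subspace $M$ of $X$, different from $\{0\}$ and $X$, such that $TM\subset M$. The space $X$ satisfies the Invariant Subspace Property if every $T\in L(X)$ possesses a non-trivial invariant subspace. *)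

(* Defs.v *)
From HB Require Import structures.
From mathcomp Require Import all_boot all_order all_algebra.
From mathcomp Require Import all_classical all_reals all_analysis.
From mathcomp Require Import complex.
Set Implicit Arguments.
Unset Strict Implicit.
Unset Printing Implicit Defensive.
Import Order.TTheory GRing.Theory Num.Theory.
Import numFieldNormedType.Exports.
Local Open Scope classical_set_scope.
Local Open Scope ring_scope.

Variant scalar_kind := RealScalars | ComplexScalars.

Definition scalars (R : realType) (k : scalar_kind) : numFieldType :=
  match k with RealScalars => R | ComplexScalars => R[i] end.

(* MathComp's norm on R[i] takes its values in R[i], hence the projection. *)
Definition modulus (R : realType) (k : scalar_kind) : scalars R k -> R :=
  match k with
  | RealScalars => fun a : R => `|a|
  | ComplexScalars => fun a : R[i] => complex.Re `|a|
  end.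

Section FrechetSpaces.
Context {R : realType} {k : scalar_kind} {X : topologicalLmodType (scalars R k)}.
Implicit Types (p : nat -> X -> R) (q : X -> R) (M N : set X).

Definition seminorm q : Prop :=
  [/\ forall x, 0 <= q x,
      forall x y, q (x + y) <= q x + q y
    & forall (a : scalars R k) x, q (a *: x) = modulus a * q x].

Definition is_norm q : Prop := seminorm q /\ forall x, q x = 0 -> x = 0.

Definition ker q : set X := [set x | q x = 0].

(* Sequences of seminorms are indexed from 0: [p j] stands for the seminorm
   usually written $p_{j+1}$. *)

Definition nondecreasing_seminorms p : Prop :=
  forall j x, p j x <= p j.+1 x.

Definition separating p : Prop := forall x : X, (forall j, p j x = 0) -> x = 0.

(* The sets [[set y | forall j, (j <= n)%N -> p j (y - x) < e]] are the usual
   basic neighbourhoods of x, given by finitely many of the seminorms. *)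
Definition induces_topology p : Prop :=
  forall (x : X) (U : set X), nbhs x U <->
    exists n (e : R), 0 < e /\
      [set y | forall j, (j <= n)%N -> p j (y - x) < e] `<=` U.

Definition frechet_dist p (x y : X) : R :=
  limn (series (fun j => 2^-1 ^+ j.+1 * Num.min 1 (p j (x - y)))).

Definition complete_dist (d : X -> X -> R) : Prop :=
  forall u : nat -> X,
    (forall e : R, 0 < e ->
       exists n0, forall m n, (n0 <= m)%N -> (n0 <= n)%N -> d (u m) (u n) < e) ->
    exists x, d (u n) x @[n --> \oo] --> (0 : R).

Definition frechet p : Prop :=
  [/\ forall j, seminorm (p j), nondecreasing_seminorms p, separating p,
      induces_topology p & complete_dist (frechet_dist p)].

(* N is a linear subspace of M and M / N is spanned by finitely many classes. *)
Definition finite_codim_in N M : Prop :=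
  [/\ submod_closed (mem N), N `<=` M
    & exists n (e : 'I_n -> X), (forall i, M (e i)) /\
        forall x, M x -> exists a : 'I_n -> scalars R k,
          N (x - \sum_(i < n) a i *: e i)].

End FrechetSpaces.

Section Operators.
Context {R : realType} {k : scalar_kind} (X : topologicalLmodType (scalars R k)).

Definition without_continuous_norm : Prop :=
  ~ exists q : X -> R, is_norm q /\ continuous q.

Definition nontrivial_invariant_subspace (T : X -> X) (M : set X) : Prop :=
  [/\ submod_closed (mem M), closed M, M <> [set 0], M <> setT
    & T @` M `<=` M].

Definition invariant_subspace_property : Prop :=
  forall T : {linear X -> X}, continuous (T : X -> X) ->
    exists M : set X, nontrivial_invariant_subspace T M.

End Operators.

(* Main.v *)
From HB Require Import structures.
Require Import Defs.
From mathcomp Require Import all_boot all_order all_algebra.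
From mathcomp Require Import all_classical all_reals all_analysis.
From mathcomp Require Import complex lra.
Set Implicit Arguments.
Unset Strict Implicit.
Unset Printing Implicit Defensive.
Import Order.TTheory GRing.Theory Num.Theory.
Import numFieldNormedType.Exports.
Local Open Scope classical_set_scope.
Local Open Scope ring_scope.

(** Write K_j for the kernel of p_j, let j0 be the index from which the
    codimensions are finite, and put Y = K_j0.  Since no p_j is a norm, every
    K_j is nonzero; by finite codimension and completeness, Y is a copy of the
    space of all scalar sequences, on which infinitely many linear equations
    can be solved one after the other.

    Continuity of T gives some m >= j0 with T K_m inside Y.  As K_m has finite
    codimension in Y, finitely many continuous functionals g_1, ..., g_d, each
    bounded by the seminorm x |-> p_j0 (T x), decide whether T maps a vector of
    Y back into Y ([finite_separation], a consequence of Hahn-Banach).  Add to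
    them one nonzero continuous functional g_0 and look at the sequences
    (g_i (T^n x))_n for x in Y.

    - Suppose that for some g = g_i and for every n there is x in Y with
      g (T^l x) = 0 for l < n and g (T^n x) = 1.  The functionals g o T^n are
      then so independent on Y that the values g (T^n x) can be prescribed at
      will ([prescribed_values]).  Choosing g x = 1 and g (T^n x) = 0 for n > 0
      shows that the closed subspace of the x with g (T^n x) = 0 for all n > 0
      is nonzero; it is proper since g o T is nonzero on Y
      ([invariant_subspace_free_orbit]).

    - Otherwise each i has an index n_i such that, for x in Y, the vanishing of
      g_i (T^l x) for l < n_i entails that of g_i (T^n_i x).  Let D > 0 bound
      all the n_i.  The x in Y such that g_i (T^l x) = 0 for all i and all
      l < D form a closed invariant subspace: it is proper because g_0 kills
      it, and nonzero because finitely many continuous functionals always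
      vanish together on some K_j ([invariant_subspace_bound_orbit]).

    The solvability of the equations rests on [leading_finite_codim]: passing
    to a subspace of finite codimension destroys the triangular shape of the
    system in finitely many rows only, so that the corrections made at later
    and later rows can be taken in smaller and smaller K_j, and their sum
    converges. *)

(** * The Hahn-Banach theorem *)

Section Sublinear.
Context {R : realType} {V : lmodType R}.
Implicit Types (s q : V -> R) (A : set (V -> R)).

Definition sublinear s : Prop :=
  (forall x y, s (x + y) <= s x + s y) /\
  (forall (r : R) x, 0 <= r -> s (r *: x) <= r * s x).

Lemma sublinear0 s : sublinear s -> s 0 = 0.
Proof.
move=> [sD sZ]; apply/eqP; rewrite eq_le.
have := sD 0 0; rewrite addr0 -subr_ge0 addrK => ->.
by have := sZ 0 0 (lexx _); rewrite scale0r mul0r => ->.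
Qed.

Lemma sublinear_lower s x : sublinear s -> - s (- x) <= s x.
Proof.
move=> ss; have [sD _] := ss.
by rewrite -subr_ge0 opprK -(sublinear0 ss) -(subrr x).
Qed.

Lemma sublinearZ s (r : R) x : sublinear s -> 0 <= r -> s (r *: x) = r * s x.
Proof.
move=> ss; have [_ sZ] := ss; rewrite le_eqVlt => /orP[/eqP<-|r0].
  by rewrite scale0r mul0r sublinear0.
apply/eqP; rewrite eq_le (sZ _ _ (ltW r0)) /=.
have ri0 : 0 <= r^-1 by rewrite invr_ge0 ltW.
have := sZ _ (r *: x) ri0.
by rewrite scalerA mulVf ?gt_eqF // scale1r ler_pdivlMl.
Qed.

Definition lower_envelope A (x : V) : R := inf [set s x | s in A].

Lemma lower_envelope_le A b s : (forall s x, A s -> b x <= s x) -> A s ->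
  forall x, lower_envelope A x <= s x.
Proof.
move=> Ab As x; apply: ge_inf; last by exists s.
by exists (b x) => _ [t At <-]; exact: Ab.
Qed.

Lemma lower_envelope_sublinear A b : A !=set0 ->
  (forall s x, A s -> b x <= s x) ->
  (forall s t, A s -> A t -> exists2 w, A w &
     forall x y, w (x + y) <= s x + t y) ->
  (forall s (r : R), A s -> 0 <= r -> exists2 w, A w &
     forall x, w (r *: x) <= r * s x) ->
  sublinear (lower_envelope A).
Proof.
move=> [s0 As0] Ab AD AZ; have le_env := lower_envelope_le Ab.
have env_ge x c : (forall s, A s -> c <= s x) -> c <= lower_envelope A x.
  move=> h; apply: lb_le_inf; first by exists (s0 x), s0.
  by move=> _ [s As <-]; exact: h.
split=> [x y|r x r0].
  rewrite -lerBlDl; apply/env_ge => t At; rewrite lerBlDr -lerBlDl.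
  apply/env_ge => s As; rewrite lerBlDl.
  have [w Aw wD] := AD _ _ As At; rewrite [leRHS]addrC.
  by apply: le_trans (wD x y); exact: le_env.
move: r0; rewrite le_eqVlt => /orP[/eqP<-|r0].
  have [w Aw wZ] := AZ _ 0 As0 (lexx _).
  by rewrite mul0r; have := wZ x; rewrite mul0r; apply: le_trans; exact: le_env.
rewrite -ler_pdivrMl //; apply/env_ge => s As.
rewrite ler_pdivrMl //; have [w Aw wZ] := AZ _ r As (ltW r0).
by apply: le_trans (wZ x); exact: le_env.
Qed.

(** If s is linear, [tilt s u t] is s for every t.  In general its infimum over
    t >= 0, [straighten s u] below, is sublinear and at most s, so that it is s
    again when s is minimal: this is where minimality turns into linearity. *)
Definition tilt s (u : V) (t : R) (y : V) : R := s (y + t *: u) - t * s u.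

Definition straighten s u : V -> R :=
  lower_envelope [set tilt s u t | t in [set t | 0 <= t]].

Lemma tilt_lower s u t y : sublinear s -> 0 <= t -> - s (- y) <= tilt s u t y.
Proof.
move=> ss t0; rewrite lerBrDl lerBlDr -sublinearZ //.
by have := ss.1 (y + t *: u) (- y); rewrite addrAC subrr add0r.
Qed.

Lemma straighten_le s u t y : sublinear s -> 0 <= t ->
  straighten s u y <= s (y + t *: u) - t * s u.
Proof.
move=> ss t0; apply: (@lower_envelope_le _ (fun y => - s (- y)) (tilt s u t)).
  by move=> _ x [t' t'0 <-]; exact: tilt_lower.
by exists t.
Qed.

Lemma straighten_le_self s u y : sublinear s -> straighten s u y <= s y.
Proof.
move=> ss; have := straighten_le u y ss (lexx _).
by rewrite scale0r addr0 mul0r subr0.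
Qed.

Lemma straighten_sublinear s u : sublinear s -> sublinear (straighten s u).
Proof.
move=> ss; have [sD sZ] := ss.
apply: (@lower_envelope_sublinear _ (fun y => - s (- y))).
- by exists (tilt s u 0), 0 => /=.
- by move=> _ x [t' t'0 <-]; exact: tilt_lower.
- move=> _ _ [t t0 <-] [t' t'0 <-]; exists (tilt s u (t + t')).
    by exists (t + t') => //=; rewrite addr_ge0.
  move=> x y; rewrite /tilt scalerDl mulrDl opprD addrACA [leRHS]addrACA.
  by rewrite lerD2r; exact: sD.
- move=> _ r [t t0 <-] r0; exists (tilt s u (r * t)).
    by exists (r * t) => //=; rewrite mulr_ge0.
  move=> x; rewrite /tilt -scalerA -scalerDr mulrBr mulrA lerD2r.
  exact: sZ.
Qed.

(** Zorn's lemma applied to whole functionals rather than to extensions from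
    subspaces: a chain of sublinear functionals is bounded below by its lower
    envelope. *)
Lemma minimal_sublinear q : sublinear q -> exists s : V -> R,
  [/\ sublinear s, forall x, s x <= q x &
      forall s', sublinear s' -> (forall x, s' x <= s x) -> s' = s].
Proof.
move=> qs; pose T := {s : V -> R | sublinear s /\ forall x, s x <= q x}.
pose r (s t : T) := `[< forall x, sval t x <= sval s x >].
have [| | | |s min_s] := @Zorn T r.
- by move=> t; apply/asboolP.
- move=> a b c /asboolP ab /asboolP bc; apply/asboolP => x.
  by apply: le_trans (bc x) (ab x).
- move=> [a aq] [b bq] /asboolP /= ab /asboolP /= ba; apply: eq_exist.
  by apply/funext => x; apply/eqP; rewrite eq_le ab ba.
- move=> A Atot; have [[a0 Aa0]|] := pselect (A !=set0); last first.
    move=> A0; exists (exist _ q (conj qs (fun x => lexx (q x)))) => s As.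
    by case: A0; exists s.
  pose A' := [set sval s | s in A].
  have A'b s x : A' s -> - q (- x) <= s x.
    move=> [[/= a [sa aq]] _ <-]; apply: le_trans (sublinear_lower x sa).
    by rewrite lerN2.
  have se : sublinear (lower_envelope A').
    apply: (lower_envelope_sublinear _ A'b).
    - by exists (sval a0), a0.
    - move=> _ _ [s As <-] [t At <-].
      have [/asboolP st|/asboolP st] := Atot _ _ As At.
        exists (sval t); first by exists t.
        move=> x y; apply: (le_trans ((svalP t).1.1 x y)).
        by rewrite lerD2r.
      exists (sval s); first by exists s.
      move=> x y; apply: (le_trans ((svalP s).1.1 x y)).
      by rewrite lerD2l.
    - move=> _ c [s As <-] c0; exists (sval s); first by exists s.
      by move=> x; exact: (svalP s).1.2.
  have eq_ x : lower_envelope A' x <= q x.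
    apply: le_trans ((svalP a0).2 x).
    by apply: lower_envelope_le A'b _ x; exists a0.
  exists (exist _ (lower_envelope A') (conj se eq_)) => s As; apply/asboolP => x /=.
  by apply: lower_envelope_le A'b _ x; exists s.
exists (sval s); split; [exact: (svalP s).1|exact: (svalP s).2|].
move=> s' ss' s's.
have s'q x : s' x <= q x by apply: le_trans (s's x) ((svalP s).2 x).
by have <- // : exist _ s' (conj ss' s'q) = s by apply: min_s; apply/asboolP.
Qed.

(** A minimal sublinear functional s equals all its straightenings, and
    [straighten s x y <= s (y + x) - s x] then makes it additive.  Starting
    from [straighten q u] instead of q forces the value at u, because
    [straighten q u (- u) <= - q u]. *)
Lemma Hahn_Banach_sublinear q (u : V) : sublinear q ->
  exists h : {scalar V}, (forall x, h x <= q x) /\ h u = q u.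
Proof.
move=> qs; have [s [ss sq s_min]] := minimal_sublinear (straighten_sublinear u qs).
have sD : {morph s : x y / x + y}.
  move=> y x; apply/eqP; rewrite eq_le ss.1 /=.
  have sx : straighten s x = s.
    apply: s_min (straighten_sublinear x ss) _ => z.
    exact: straighten_le_self.
  by have := straighten_le x y ss ler01; rewrite sx scale1r mul1r lerBrDr.
have sN x : s (- x) = - s x.
  by apply/eqP; rewrite -addr_eq0 -sD addNr sublinear0.
have s_lin : linear_for *%R s.
  move=> r x y; rewrite sD; congr (_ + _).
  have [r0|r0] := leP 0 r; first exact: sublinearZ.
  rewrite -[r]opprK scaleNr sN sublinearZ ?mulNr //.
  by rewrite oppr_ge0 ltW.
pose h := HB.pack_for {scalar V} s (GRing.isLinear.Build _ _ _ _ s s_lin).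
have hq x : h x <= q x.
  by apply: le_trans (sq x) _; exact: straighten_le_self.
exists h; split => //; apply/eqP; rewrite eq_le hq /= -lerN2 -[- h u]sN.
apply: (le_trans (sq _)); have := straighten_le u (- u) qs ler01.
by rewrite scale1r addNr mul1r sublinear0 // sub0r.
Qed.

End Sublinear.

(** An alias that carries the real vector space underlying a complex one, so
    that the real theorem applies to it. *)
Definition realify {R : realType} (V : lmodType R[i]) : Type := V.

Section Realify.
Context {R : realType} (V : lmodType R[i]).

HB.instance Definition _ := GRing.Zmodule.on (realify V).

Let rscale (r : R) (x : realify V) : realify V := (r%:C)%C *: (x : V).

Let rscaleA a b v : rscale a (rscale b v) = rscale (a * b) v.
Proof. by rewrite /rscale scalerA rmorphM. Qed.

Let rscale1 : left_id 1 rscale.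
Proof. by move=> v; rewrite /rscale scale1r. Qed.

Let rscaleDr : right_distributive rscale +%R.
Proof. by move=> r x y; rewrite /rscale scalerDr. Qed.

Let rscaleDl v : {morph rscale^~ v : a b / a + b}.
Proof. by move=> a b; rewrite /rscale rmorphD scalerDl. Qed.

HB.instance Definition _ := GRing.Zmodule_isLmodule.Build R (realify V)
  rscaleA rscale1 rscaleDr rscaleDl.

Lemma realify_scaleE (r : R) (x : realify V) :
  r *: x = (r%:C)%C *: (x : V) :> V.
Proof. by []. Qed.

End Realify.

Section Scalars.
Context {R : realType}.

Lemma Re_le_modulus (z : R[i]) : complex.Re z <= complex.Re `|z|.
Proof.
apply: (le_trans (ler_norm _)).
by have := normc_ge_Re z; rewrite lecE => /andP[_].
Qed.

Let cmod (z : R[i]) : R := complex.Re `|z|.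

Let cmodE z : cmod z = Num.sqrt (complex.Re z ^+ 2 + complex.Im z ^+ 2).
Proof. by rewrite /cmod normc_def. Qed.

Let cmod_eq0 z : cmod z = 0 -> z = 0.
Proof.
move=> z0; apply/eqP; rewrite -normr_eq0.
by rewrite normc_def -cmodE z0.
Qed.

Let cmodM z w : cmod (z * w) = cmod z * cmod w.
Proof.
by rewrite /cmod normrM [in LHS]normc_def -cmodE [`|w|]normc_def -cmodE; simpc.
Qed.

Let cmodD z w : cmod (z + w) <= cmod z + cmod w.
Proof. by have := ler_normD z w; rewrite lecE => /andP[_]. Qed.

Let cmod_ge0 z : 0 <= cmod z.
Proof. by rewrite cmodE sqrtr_ge0. Qed.

Let cmod_real (r : R) : cmod (r%:C)%C = `|r|.
Proof. by rewrite cmodE /= expr0n addr0 sqrtr_sqr. Qed.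

Context {k : scalar_kind}.
Implicit Types a b : scalars R k.

Lemma modulus0 : modulus (0 : scalars R k) = 0.
Proof. by case: k; rewrite /modulus normr0. Qed.

Lemma modulus1 : modulus (1 : scalars R k) = 1.
Proof. by case: k; rewrite /modulus normr1. Qed.

Lemma modulus_eq0 a : modulus a = 0 -> a = 0.
Proof.
by case: k a => a; [move/eqP; rewrite normr_eq0 => /eqP|exact: cmod_eq0].
Qed.

Lemma modulusM a b : modulus (a * b) = modulus a * modulus b.
Proof. by case: k a b => a b; [exact: normrM|exact: cmodM]. Qed.

Lemma modulusD a b : modulus (a + b) <= modulus a + modulus b.
Proof. by case: k a b => a b; [exact: ler_normD|exact: cmodD]. Qed.

Lemma modulusN a : modulus (- a) = modulus a.
Proof. by case: k a => a; rewrite /modulus normrN. Qed.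

Lemma modulus_ge0 a : 0 <= modulus a.
Proof. by case: k a => a; [exact: normr_ge0|exact: cmod_ge0]. Qed.

Lemma modulus_onto (r : R) : 0 <= r -> exists a, modulus a = r.
Proof.
move=> r0; case: k; first by exists r; exact: ger0_norm.
by exists (r%:C)%C; have := cmod_real r; rewrite ger0_norm.
Qed.

End Scalars.

Section HahnBanach.
Context {R : realType}.

Lemma Hahn_Banach_real (V : lmodType R) (q : V -> R) (u : V) :
    (forall x y, q (x + y) <= q x + q y) ->
    (forall (a : R) x, q (a *: x) = `|a| * q x) ->
  exists h : {scalar V}, (forall x, `|h x| <= q x) /\ h u = q u.
Proof.
move=> qD qZ.
have qs : sublinear q by split=> // r x r0; rewrite qZ ger0_norm.
have [h [hq hu]] := Hahn_Banach_sublinear u qs.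
exists h; split => // x; rewrite ler_norml hq andbT lerNl -linearN.
by apply: le_trans (hq _) _; rewrite -scaleN1r qZ normrN1 mul1r.
Qed.

(** A complex functional is recovered from its real part h as
    x |-> h x - i h (i x); rotating x so that the value becomes real transfers
    the bound from h to the modulus. *)
Lemma Hahn_Banach_complex (V : lmodType R[i]) (q : V -> R) (u : V) :
    (forall x y, q (x + y) <= q x + q y) ->
    (forall (a : R[i]) x, q (a *: x) = complex.Re `|a| * q x) ->
  exists h : {scalar V}, (forall x, complex.Re `|h x| <= q x) /\
    complex.Re `|h u| = q u.
Proof.
move=> qD qZ.
have qs : @sublinear R (realify V) q.
  split=> // r x r0; rewrite [r *: x]realify_scaleE qZ normc_def /=.
  by rewrite expr0n addr0 sqrtr_sqr ger0_norm.
have [h [hq hu]] := Hahn_Banach_sublinear (u : realify V) qs.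
have hZ (r : R) (x : V) : h ((r%:C)%C *: x) = r * h x.
  exact: (scalarZ h r (x : realify V)).
have hD (x y : V) : h (x + y) = h x + h y by rewrite -(linearD h).
pose H (x : V) : R[i] := (h x +i* - h ('i *: x))%C.
have HD x y : H (x + y) = H x + H y.
  by rewrite /H scalerDr !hD opprD.
have Hr (r : R) x : H ((r%:C)%C *: x) = (r%:C)%C * H x.
  rewrite /H scalerA mulrC -scalerA !hZ; apply/eqP.
  by rewrite eq_complex /= !mul0r subr0 addr0 mulrN !eqxx.
have hN x : h (- x) = - h x by rewrite -(linearN h).
have Hi x : H ('i%C *: x) = 'i%C * H x.
  rewrite /H scalerA -expr2 sqr_i scaleN1r hN; apply/eqP.
  by rewrite eq_complex /= !mul0r !mul1r sub0r !opprK add0r !eqxx.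
have H_lin : linear_for *%R H.
  move=> a x y; rewrite HD; congr (_ + _).
  by rewrite [a]complexE scalerDl -scalerA HD !Hr Hi !Hr mulrDl mulrA.
pose L := HB.pack_for {scalar V} H (GRing.isLinear.Build _ _ _ _ H H_lin).
have Lq x : complex.Re `|L x| <= q x.
  have [->|L0] := eqVneq (L x) 0.
    rewrite normr0 /=; have := qZ 0 x; rewrite scale0r normr0 mul0r => q0.
    have := qD x (- x); rewrite subrr q0 -[- x]scaleN1r qZ normrN1 mul1r.
    by rewrite -mulr2n pmulrn_lge0.
  set z := L x in L0 *.
  have := hq (`|z| / z *: x); rewrite qZ normf_div normr_id divff ?normr_eq0 //.
  rewrite mul1r.
  suff -> : h (`|z| / z *: x) = complex.Re `|z| by [].
  have -> : h (`|z| / z *: x) = complex.Re (L (`|z| / z *: x)) by [].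
  by rewrite scalarZ -/z divfK.
exists L; split => //; apply/eqP; rewrite eq_le Lq -hu.
exact: (Re_le_modulus (L u)).
Qed.

Theorem Hahn_Banach_seminorm {k : scalar_kind}
    {X : topologicalLmodType (scalars R k)} (q : X -> R) (u : X) :
  seminorm q -> exists h : {scalar X},
    (forall x, modulus (h x) <= q x) /\ modulus (h u) = q u.
Proof.
case: k X q u => X q u [q0 qD qZ].
  have [h [hq hu]] := Hahn_Banach_real u qD qZ.
  by exists h; split=> //=; rewrite hu ger0_norm.
exact: Hahn_Banach_complex.
Qed.

End HahnBanach.

(** * Seminorms and convergence in a Frechet space *)

Section Seminorm.
Context {R : realType} {k : scalar_kind} {X : topologicalLmodType (scalars R k)}.
Variable q : X -> R.
Hypothesis q_semi : seminorm q.

Lemma seminorm_ge0 x : 0 <= q x. Proof. by case: q_semi. Qed.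

Lemma seminormD x y : q (x + y) <= q x + q y. Proof. by case: q_semi. Qed.

Lemma seminormZ (a : scalars R k) x : q (a *: x) = modulus a * q x.
Proof. by case: q_semi. Qed.

Lemma seminorm0 : q 0 = 0.
Proof. by rewrite -(scale0r 0) seminormZ modulus0 mul0r. Qed.

Lemma seminormN x : q (- x) = q x.
Proof. by rewrite -scaleN1r seminormZ modulusN modulus1 mul1r. Qed.

Lemma seminorm_dist x y : `|q x - q y| <= q (x - y).
Proof.
rewrite ler_norml; apply/andP; split.
  by rewrite lerNl opprB -[x - y]opprB seminormN lerBlDr -[in leLHS](subrK x y) seminormD.
by rewrite lerBlDr -[in leLHS](subrK y x) seminormD.
Qed.

Lemma kerD x y : q x = 0 -> q y = 0 -> q (x + y) = 0.
Proof.
move=> x0 y0; apply/eqP; rewrite eq_le seminorm_ge0 andbT.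
by apply: le_trans (seminormD _ _) _; rewrite x0 y0 addr0.
Qed.

Lemma kerZ (a : scalars R k) x : q x = 0 -> q (a *: x) = 0.
Proof. by move=> x0; rewrite seminormZ x0 mulr0. Qed.

End Seminorm.

Lemma seminorm_scalar {R : realType} {k : scalar_kind}
    {X : topologicalLmodType (scalars R k)} (h : {scalar X}) :
  seminorm (fun x => modulus (h x)).
Proof.
split=> [x|x y|a x]; first exact: modulus_ge0.
  by rewrite linearD; exact: modulusD.
by rewrite scalarZ modulusM.
Qed.

Lemma seminorm_comp {R : realType} {k : scalar_kind}
    {X : topologicalLmodType (scalars R k)} (q : X -> R) (T : {linear X -> X}) :
  seminorm q -> seminorm (q \o T).
Proof.
move=> q_semi; split=> [x|x y|a x] /=; first exact: seminorm_ge0.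
  by rewrite linearD; exact: seminormD.
by rewrite linearZ; exact: seminormZ.
Qed.

Section Frechet.
Context {R : realType} {k : scalar_kind} {X : topologicalLmodType (scalars R k)}.
Variable p : nat -> X -> R.
Hypothesis X_frechet : frechet p.

Let p_semi j : seminorm (p j). Proof. by case: X_frechet. Qed.

Lemma frechet_le i j x : (i <= j)%N -> p i x <= p j x.
Proof.
case: X_frechet => _ p_nd _ _ _.
by elim: j => [|j IH]; [case: i|rewrite leq_eqVlt => /orP[/eqP->//|/IH/le_trans]; exact].
Qed.

Lemma ker_antimono i j x : (i <= j)%N -> p j x = 0 -> p i x = 0.
Proof.
move=> ij x0; apply/eqP; rewrite eq_le (seminorm_ge0 (p_semi i)) andbT -x0.
exact: frechet_le.
Qed.

Lemma dominated_continuous (g : X -> R) j :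
  (forall x y, `|g x - g y| <= p j (x - y)) -> continuous g.
Proof.
move=> gp x; apply/cvgrPdist_lt => e e0.
have [_ _ _ p_top _] := X_frechet; apply/p_top.
exists j, e; split=> // y /(_ j (leqnn j)) yx /=.
by rewrite distrC; exact: le_lt_trans (gp _ _) yx.
Qed.

Lemma continuous_seminorm j : continuous (p j).
Proof. by apply: (@dominated_continuous _ j) => x y; exact: seminorm_dist. Qed.

(** A seminorm that is bounded on a basic neighbourhood of 0 is bounded on
    the subspace ker (p m) contained in it, hence vanishes there. *)
Lemma continuous_seminorm_ker (q : X -> R) : seminorm q -> continuous q ->
  exists m, forall x, p m x = 0 -> q x = 0.
Proof.
move=> q_semi q_cont.
have : nbhs (0 : X) [set x | q x < 1].
  have := q_cont 0; rewrite /continuous_at (seminorm0 q_semi).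
  by move/cvgr_lt; apply; exact: ltr01.
have [_ _ _ p_top _] := X_frechet => /p_top[m [e [e0 me]]].
exists m => x x0; apply/eqP/contraT => qx0.
have qx_gt0 : 0 < q x by rewrite lt_neqAle eq_sym qx0 seminorm_ge0.
have [a ma] : exists a : scalars R k, modulus a = (q x)^-1.
  by apply: modulus_onto; rewrite invr_ge0 ltW.
suff : q (a *: x) < 1 by rewrite (seminormZ q_semi) ma mulVf // ltxx.
apply: me => j jm; rewrite subr0 (seminormZ (p_semi j)) (ker_antimono jm x0).
by rewrite mulr0.
Qed.

Let term (x y : X) j : R := 2^-1 ^+ j.+1 * Num.min 1 (p j (x - y)).

Let term_ge0 x y j : 0 <= term x y j.
Proof.
by rewrite mulr_ge0 ?exprn_ge0 ?invr_ge0 ?ler0n // le_min ler01 seminorm_ge0.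
Qed.

Let term_le x y j : term x y j <= 2^-1 ^+ j.+1.
Proof.
by rewrite ler_piMr ?exprn_ge0 ?invr_ge0 ?ler0n // ge_min lexx.
Qed.

Let series_nd x y : nondecreasing_seq (series (term x y)).
Proof.
apply/nondecreasing_seqP => n; rewrite /series /= big_nat_recr //= lerDl.
exact: term_ge0.
Qed.

Let series_le x y n m : p n (x - y) = 0 ->
  series (term x y) m <= 2^-1 ^+ n.
Proof.
move=> xy0.
have low i : (i <= n)%N -> series (term x y) i = 0.
  move=> ie; rewrite /series /= big_nat big1 // => j /andP[_ ji].
  rewrite /term (ker_antimono _ xy0); last by exact: ltnW (leq_trans ji ie).
  by rewrite minElt ltNge ler01 /= mulr0.
have [mn|nm] := leqP m n; first by rewrite low // exprn_ge0 // invr_ge0.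
rewrite -(subnK (ltnW nm)); move: (m - n)%N => d.
(* from index n on, the terms sum to at most a tail of the geometric series *)
suff : series (term x y) (d + n) <= 2^-1 ^+ n - 2^-1 ^+ (d + n).
  move/le_trans; apply; rewrite gerBl exprn_ge0 // invr_ge0 //.
elim: d => [|d IH]; first by rewrite add0n low // subrr.
rewrite addSn /series /= big_nat_recr //=; apply: le_trans (lerD IH (term_le _ _ _)) _.
by rewrite exprS; lra.
Qed.

Let series_cvg x y : cvgn (series (term x y)).
Proof.
apply: nondecreasing_is_cvgn; first exact: series_nd.
exists 1 => _ [m _ <-]; apply: (@le_trans _ _ (1 - 2^-1 ^+ m)); last first.
  by rewrite gerBl exprn_ge0 // invr_ge0.
elim: m => [|m IH]; first by rewrite /series /= big_geq // subrr.
rewrite /series /= big_nat_recr //=; apply: le_trans (lerD IH (term_le _ _ _)) _.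
by rewrite exprS; lra.
Qed.

Lemma frechet_dist_le n x y : p n (x - y) = 0 -> frechet_dist p x y <= 2^-1 ^+ n.
Proof.
move=> xy0; apply: limr_le; first exact: series_cvg.
by apply: nearW => m; exact: series_le.
Qed.

Lemma frechet_dist_ge j x y :
  2^-1 ^+ j.+1 * Num.min 1 (p j (x - y)) <= frechet_dist p x y.
Proof.
apply: (@le_trans _ _ (series (term x y) j.+1)); last first.
  exact: nondecreasing_cvgn_le (@series_nd _ _) (@series_cvg _ _) _.
rewrite /series /= big_nat_recr //= lerDr; apply: sumr_ge0 => i _.
exact: term_ge0.
Qed.

(** A series whose terms eventually lie in each ker (p j) is Cauchy for trivial
    reasons; modulo any ker (p j) its sum is a finite partial sum, so that a
    functional vanishing on ker (p j) sees only finitely many terms. *)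
Lemma frechet_tail_limit (u : nat -> X) :
  (forall j, exists N, forall n, (N <= n)%N -> p j (u n.+1 - u n) = 0) ->
  exists x, forall j, exists N, forall n, (N <= n)%N -> p j (x - u n) = 0.
Proof.
move=> u_tail.
have u_const j : exists N, forall m n, (N <= n)%N -> (n <= m)%N ->
    p j (u m - u n) = 0.
  have [N uN] := u_tail j; exists N => m n Nn nm.
  rewrite -(subnK nm); elim: (m - n)%N => [|d IH].
    by rewrite add0n subrr (seminorm0 (p_semi j)).
  rewrite addSn -(subrK (u (d + n)) (u _)) -addrA.
  apply: (kerD (p_semi j)) => //; apply: uN.
  exact: leq_trans Nn (leq_addl _ _).
have [_ _ _ _ p_compl] := X_frechet.
have [|x ux] := p_compl u.
  move=> e e0.
  have [j je] : exists j, (2^-1 : R) ^+ j < e.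
    have /cvgrPdist_lt/(_ e e0)[j _ /(_ j (leqnn j))] : (2^-1 : R) ^+ n @[n --> \oo] --> 0.
      by apply: cvg_expr; rewrite ger0_norm ?invr_ge0 // invf_lt1 ?ltr1n.
    by rewrite /= sub0r normrN => /(le_lt_trans (ler_norm _)); exists j.
  have [N uN] := u_const j; exists N => m n Nm Nn.
  apply: le_lt_trans (frechet_dist_le _) je.
  have [nm|/ltnW mn] := leqP n m; first exact: uN.
  by rewrite -(seminormN (p_semi j)) opprB; exact: uN.
exists x => j; have [N uN] := u_const j; exists N => n Nn.
apply/eqP; rewrite eq_le (seminorm_ge0 (p_semi j)) andbT.
apply/ler_addgt0Pl => e e0; rewrite addr0.
pose c : R := 2^-1 ^+ j.+1 * Num.min 1 e.
have c_gt0 : 0 < c by rewrite mulr_gt0 ?exprn_gt0 ?invr_gt0 // lt_min ltr01.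
move/cvgrPdist_lt: ux => /(_ c c_gt0)[M _ Mc].
have := Mc (maxn M n) (leq_maxl _ _) => /=; rewrite sub0r normrN.
move/(le_lt_trans (ler_norm _)) => /(le_lt_trans (frechet_dist_ge j _ _)).
rewrite /c ltr_pM2l ?exprn_gt0 ?invr_gt0 // lt_min !gt_min ltxx /= => /andP[h1 h2].
have {h1 h2} he : p j (u (maxn M n) - x) < e.
  by case/orP: h2 => //; exact: lt_trans.
rewrite -(subrK (u (maxn M n)) x) -addrA.
apply: le_trans (seminormD (p_semi j) _ _) _.
by rewrite (uN _ _ Nn (leq_maxr _ _)) addr0 -(seminormN (p_semi j)) opprB ltW.
Qed.

End Frechet.

(** * Triangular systems of functionals *)

Section LeadingVectors.
Context {R : realType} {k : scalar_kind} {X : topologicalLmodType (scalars R k)}.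
Implicit Types (f : nat -> {scalar X}) (N M : set X).

Lemma submod_sum N n (c : 'I_n -> scalars R k) (v : 'I_n -> X) :
  submod_closed (mem N) -> (forall i, N (v i)) -> N (\sum_(i < n) c i *: v i).
Proof.
move=> [N0 NL] Nv; rewrite -in_setE; apply: (big_ind (fun x => x \in mem N)) => //.
  by move=> x y Nx Ny; rewrite -[x]scale1r; exact: NL.
by move=> i _; rewrite -[_ *: _]addr0; apply: NL => //; rewrite in_setE.
Qed.

(** x can be used to correct the n-th equation of a system f_i = c_i without
    disturbing the earlier ones: a column of a lower triangular system. *)
Definition leading f n (x : X) : Prop :=
  (forall i, (i < n)%N -> f i x = 0) /\ f n x = 1.

(** If r vectors span M modulo N, at most r indices n >= n0 are lost, in the
    sense that N has no leading vector for them.  Given r + 1 lost indices, their leading vectors in M have a nontrivial combination in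
    N, and that combination is, up to scaling, leading for the smallest index
    with a nonzero coefficient: a contradiction. *)
Lemma leading_finite_codim f N M : finite_codim_in N M ->
  (exists n0, forall n, (n0 <= n)%N -> exists2 x, M x & leading f n x) ->
  exists n0, forall n, (n0 <= n)%N -> exists2 x, N x & leading f n x.
Proof.
move=> [N_sub _ [r [e [Me Mspan]]]] [n0 M_lead]; apply: contrapT => N_lead.
have bad n : exists m, (n < m)%N /\ ((n0 <= m)%N /\
    ~ exists2 x, N x & leading f m x).
  apply: contrapT => no_bad; apply: N_lead; exists (maxn n0 n.+1) => m.
  rewrite geq_max => /andP[n0m nm]; apply: contrapT => no_x.
  by apply: no_bad; exists m.
have {bad}[next nextP] := choice bad.
(* s lists infinitely many lost indices in increasing order *)
pose s i := iter i.+1 next 0%N.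
have sS i : (s i < s i.+1)%N by case: (nextP (s i)).
have s_mono i j : (i < j)%N -> (s i < s j)%N.
  by apply: (homo_ltn ltn_trans) => {}i; exact: sS.
have sn0 i : (n0 <= s i)%N by case: (nextP (iter i next 0%N)) => _ [].
have s_bad i : ~ exists2 x, N x & leading f (s i) x.
  by case: (nextP (iter i next 0%N)) => _ [].
have /choice[v vP] i : exists x, M x /\ leading f (s i) x.
  by have [x] := M_lead _ (sn0 i); exists x.
have /choice[a aP] i : exists c : 'I_r -> scalars R k,
    N (v i - \sum_(j < r) c j *: e j) by apply: Mspan; case: (vP i).
pose A : 'M[scalars R k]_(r.+1, r) := \matrix_(i, j) a i j.
have kerA0 : kermx A != 0.
  rewrite kermx_eq0 /row_free; apply/negP => /eqP rkA.
  by have := rank_leq_col A; rewrite rkA ltnn.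
have [w wA w0] : exists2 w : 'rV_r.+1, w *m A = 0 & w != 0.
  by have /rowV0Pn[w /sub_kermxP wA w0] := kerA0; exists w.
have [i0 wi0] : exists i, w 0 i != 0.
  apply: contrapT => h; case/eqP: w0; apply/rowP => i; rewrite mxE.
  by apply/eqP; apply: contrapT => /negP hi; apply: h; exists i.
have {i0 wi0}[i wi i_min] :=
  @arg_minnP _ i0 (fun i => w 0 i != 0) (fun i : 'I_r.+1 => i : nat) wi0.
pose z := \sum_(l < r.+1) w 0 l *: v l.
have Nz : N z.
  suff -> : z = \sum_(l < r.+1) w 0 l *: (v l - \sum_(j < r) a l j *: e j).
    by apply: submod_sum => // l; exact: aP.
  rewrite (eq_bigr _ (fun l _ => scalerBr _ _ _)) sumrB.
  rewrite [X in _ - X](_ : _ = 0) ?subr0 //.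
  under eq_bigr do rewrite scaler_sumr.
  rewrite exchange_big big1 // => j _.
  under eq_bigr do rewrite scalerA.
  rewrite -scaler_suml; move/rowP: wA => /(_ j); rewrite !mxE.
  by under eq_bigr do rewrite mxE; move=> ->; rewrite scale0r.
have fz n : f n z = \sum_(l < r.+1) w 0 l * f n (v l).
  by rewrite linear_sum; apply: eq_bigr => l _; rewrite scalarZ.
apply: (s_bad i); exists ((w 0 i)^-1 *: z).
  rewrite -in_setE -[_ *: z]addr0; case: N_sub => N0 NL.
  by apply: NL => //; rewrite in_setE.
split=> [n ns|]; rewrite scalarZ fz.
  rewrite big1 ?mulr0 // => l _; have [li|il] := ltnP l i.
    have /eqP -> : w 0 l == 0 by apply/contraT => /i_min; rewrite leqNgt li.
    by rewrite mul0r.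
  have [_ [lead _]] := vP l; rewrite lead ?mulr0 //.
  apply: leq_trans ns _; move: il; rewrite leq_eqVlt => /orP[/eqP->//|].
  by move/s_mono/ltnW.
rewrite (bigD1 i) //= big1 ?addr0 => [|l li].
  by have [_ [_ ->]] := vP i; rewrite mulr1 mulVf.
have [lti|il] := ltnP l i.
  have /eqP -> : w 0 l == 0 by apply/contraT => /i_min; rewrite leqNgt lti.
  by rewrite mul0r.
have [_ [lead _]] := vP l; rewrite lead ?mulr0 //.
apply: s_mono; rewrite ltn_neqAle il andbT.
by apply: contra li => /eqP/val_inj ->.
Qed.

End LeadingVectors.

Section PrescribedValues.
Context {R : realType} {k : scalar_kind} {X : topologicalLmodType (scalars R k)}.
Variable p : nat -> X -> R.
Hypothesis X_frechet : frechet p.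
Variable j0 : nat.
Hypothesis codim : forall j, (j0 <= j)%N ->
  finite_codim_in (ker (p j.+1)) (ker (p j)).

Let p_semi j : seminorm (p j). Proof. by case: X_frechet. Qed.

Section Leading.
Variable f : nat -> {scalar X}.
Hypothesis f_lead : forall n, exists x, p j0 x = 0 /\ leading f n x.

Let lead_ker j : exists n0, forall n, (n0 <= n)%N ->
  exists2 x, ker (p j) x & leading f n x.
Proof.
elim: j => [|j [n0 IH]].
  exists 0%N => n _; have [x [x0 fx]] := f_lead n; exists x => //.
  exact: (ker_antimono X_frechet (leq0n _) x0).
have [jj0|j0j] := leqP j0 j.
  by apply: leading_finite_codim (codim jj0) _; exists n0.
exists 0%N => n _; have [x [x0 fx]] := f_lead n; exists x => //.
exact: (ker_antimono X_frechet j0j x0).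
Qed.

(** For each n the leading vector is taken in ker (p j) with j as large as
    possible, under the bound maxn n j0 that makes a largest j exist.  A given
    ker (p j) contains leading vectors for all large n, so it contains the
    chosen ones from some index on. *)
Lemma leading_vectors_to0 : exists w : nat -> X, (forall n, leading f n (w n)) /\
  forall j, exists n0, forall n, (n0 <= n)%N -> p j (w n) = 0.
Proof.
suff /choice[w wP] n : exists x, leading f n x /\ forall j, (j <= n)%N ->
    (exists2 y, ker (p j) y & leading f n y) -> p j x = 0.
  exists w; split=> [n|j]; first by case: (wP n).
  have [n0 n0P] := lead_ker j; exists (maxn n0 j) => n.
  by rewrite geq_max => /andP[n0n jn]; apply: (wP n).2 => //; exact: n0P.
pose P j := `[< (j <= maxn n j0)%N /\ exists2 y, ker (p j) y & leading f n y >].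
have exP : exists j, P j.
  have [x [x0 fx]] := f_lead n.
  by exists j0; apply/asboolP; split; [exact: leq_maxr|exists x].
have ubP j : P j -> (j <= maxn n j0)%N by move/asboolP => [].
case: (ex_maxnP exP ubP) => J /asboolP[_ [x xJ fx]] Jmax.
exists x; split=> // j jn [y yj fy].
apply: (ker_antimono X_frechet _ xJ); apply: Jmax; apply/asboolP; split.
  exact: leq_trans jn (leq_maxl _ _).
by exists y.
Qed.

Hypothesis f_ker : forall n, exists m, forall x, p m x = 0 -> f n x = 0.

(** Forward substitution with infinitely many rows; it converges because the
    n-th correction is a multiple of w n, and the w n tend to 0 in the strong
    sense of [leading_vectors_to0]. *)
Lemma prescribed_values (c : nat -> scalars R k) : exists x, forall n, f n x = c n.
Proof.
have [w [w_lead w0]] := leading_vectors_to0.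
pose y := fix y n : X :=
  if n is m.+1 then y m + (c m - f m (y m)) *: w m else 0.
have yS n : y n.+1 = y n + (c n - f n (y n)) *: w n by [].
have yP n i : (i < n)%N -> f i (y n) = c i.
  elim: n => // n IH; rewrite ltnS yS linearD scalarZ => ni.
  have [w_low w_n] := w_lead n.
  move: ni; rewrite leq_eqVlt => /orP[/eqP->|ni]; first by rewrite w_n mulr1 subrKC.
  by rewrite w_low // mulr0 addr0 IH.
have [|x xP] := frechet_tail_limit X_frechet (u := y).
  move=> j; have [n0 n0P] := w0 j; exists n0 => n nn0.
  by rewrite yS addrAC subrr add0r; apply: (kerZ (p_semi j)); exact: n0P.
exists x => n; have [m mP] := f_ker n; have [N NP] := xP m.
have := mP _ (NP (maxn N n.+1) (leq_maxl _ _)).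
by rewrite linearB /= yP ?leq_maxr // => /eqP; rewrite subr_eq0 => /eqP.
Qed.

End Leading.

End PrescribedValues.

(** * Detecting the kernel of a seminorm by finitely many functionals *)

(** One spanning vector of M modulo N is treated at a time.  If the functionals
    found so far do not suffice, the failure is witnessed by a vector u with
    q u <> 0; a Hahn-Banach functional h at u suffices as one more, since a
    vector x of M killed by the old ones is a multiple of u modulo ker q,
    where h vanishes. *)
Lemma finite_separation {R : realType} {k : scalar_kind}
    {X : topologicalLmodType (scalars R k)} (q : X -> R) (N M : set X) :
  seminorm q -> finite_codim_in N M ->
  (exists r (g : nat -> {scalar X}),
     (forall i x, (i < r)%N -> modulus (g i x) <= q x) /\
     forall x, N x -> (forall i, (i < r)%N -> g i x = 0) -> q x = 0) ->
  exists r (g : nat -> {scalar X}),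
     (forall i x, (i < r)%N -> modulus (g i x) <= q x) /\
     forall x, M x -> (forall i, (i < r)%N -> g i x = 0) -> q x = 0.
Proof.
move=> q_semi [N_sub _ [n [e [_ Mspan]]]] N_sep.
suff [r [g [gq gP]]] : exists r (g : nat -> {scalar X}),
    (forall i x, (i < r)%N -> modulus (g i x) <= q x) /\
    forall x (a : 'I_n -> scalars R k), N (x - \sum_(i < n) a i *: e i) ->
      (forall i, (i < r)%N -> g i x = 0) -> q x = 0.
  by exists r, g; split=> // x /Mspan[a xN]; exact: gP xN.
elim: n e {Mspan} => [|n IH] e.
  have [r [g [gq gP]]] := N_sep; exists r, g; split=> // x a.
  by rewrite big_ord0 subr0; exact: gP.
have [r [g [gq gP]]] := IH (fun i => e (widen_ord (leqnSn n) i)).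
pose bad u := exists2 b : 'I_n.+1 -> scalars R k,
  N (u - \sum_(i < n.+1) b i *: e i) &
  (forall i, (i < r)%N -> g i u = 0) /\ q u != 0.
have [[u [b uN [gu qu]]]|no_bad] := pselect (exists u, bad u); last first.
  exists r, g; split=> // x a xN gx; apply/eqP/contraT => qx.
  by case: no_bad; exists x, a.
have b0 : b ord_max != 0.
  apply: contra qu => /eqP b0; apply/eqP.
  apply: (gP _ (fun i => b (widen_ord (leqnSn n) i))) => //.
  by move: uN; rewrite big_ord_recr /= b0 scale0r addr0.
have [h [hq hu]] := Hahn_Banach_seminorm u q_semi.
exists r.+1, (fun i => if (i < r)%N then g i else h); split=> [i x|x a xN gx].
  by move=> _; case: ifP => ir //; exact: gq.
have gx0 := gx; have {}gx i : (i < r)%N -> g i x = 0.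
  by move=> ir; have := gx i (leqW ir); rewrite ir.
have hx : h x = 0 by have := gx0 r (leqnn _); rewrite ltnn.
(* x - c u has no component along the last spanning vector *)
pose c := a ord_max / b ord_max.
have qxu : q (x - c *: u) = 0.
  apply: (gP _ (fun i => a (widen_ord (leqnSn n) i) - c * b (widen_ord (leqnSn n) i))).
    have -> : x - c *: u - \sum_(i < n) (a (widen_ord (leqnSn n) i) -
        c * b (widen_ord (leqnSn n) i)) *: e (widen_ord (leqnSn n) i) =
      - c *: (u - \sum_(i < n.+1) b i *: e i) + (x - \sum_(i < n.+1) a i *: e i).
      rewrite !big_ord_recr /=; under eq_bigr do rewrite scalerBl -scalerA.
      rewrite sumrB -scaler_sumr scaleNr scalerBr scalerDr scalerA divfK //.
      set A := \sum_(i < n) _; set B := \sum_(i < n) _.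
      rewrite !opprB !opprD.
      by rewrite [RHS](AC (3*(1*2)) ((4*3*(1*5))*(2*6))) /= subrr addr0.
    by rewrite -in_setE; case: N_sub => _ NL; apply: NL; rewrite in_setE.
  by move=> i ir; rewrite linearB /= scalarZ gx // gu // mulr0 subr0.
have /modulus_eq0 : modulus (h (x - c *: u)) = 0.
  by apply/eqP; rewrite eq_le modulus_ge0 andbT -qxu.
rewrite linearB /= scalarZ hx sub0r => /eqP; rewrite oppr_eq0 mulf_eq0 => /orP[/eqP c0|/eqP hu0].
  by move: qxu; rewrite c0 scale0r subr0.
by move: qu; rewrite -hu hu0 modulus0 eqxx.
Qed.

(** * Invariant subspaces *)

Lemma bounded_uniform r (P : nat -> nat -> Prop) :
  (forall i n m, (n <= m)%N -> P i n -> P i m) ->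
  (forall i, (i < r)%N -> exists n, P i n) ->
  exists n, forall i, (i < r)%N -> P i n.
Proof.
move=> P_mono; elim: r => [|r IH] P_ex; first by exists 0%N.
have [|n nP] := IH; first by move=> i ir; apply: P_ex; exact: ltnW.
have [m mP] := P_ex r (leqnn _); exists (maxn n m) => i.
rewrite ltnS leq_eqVlt => /orP[/eqP->|ir].
  exact: P_mono (leq_maxr _ _) mP.
exact: P_mono (leq_maxl _ _) (nP i ir).
Qed.

Section Operator.
Context {R : realType} {k : scalar_kind} {X : topologicalLmodType (scalars R k)}.
Variable p : nat -> X -> R.
Hypothesis X_frechet : frechet p.
Variable T : {linear X -> X}.
Hypothesis T_cont : continuous (T : X -> X).
Implicit Types g : {scalar X}.

Let p_semi j : seminorm (p j). Proof. by case: X_frechet. Qed.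

Fixpoint orbit_functional (g : {scalar X}) n : {scalar X} :=
  if n is m.+1 then orbit_functional g m \o T else g.

Lemma orbit_functionalE g n x : orbit_functional g n x = g (iter n T x).
Proof. by elim: n x => // n IH x; rewrite iterSr -IH. Qed.

(** For linear g this is the continuity of g itself; stated on the modulus it
    makes the results on seminorms apply directly. *)
Definition continuous_functional (g : {scalar X}) : Prop :=
  continuous (fun x => modulus (g x)).

Lemma continuous_orbit_functional g n :
  continuous_functional g -> continuous_functional (orbit_functional g n).
Proof.
move=> g_cont; elim: n => // n IH x.
exact: (continuous_comp (@T_cont x) (IH (T x))).
Qed.

Lemma continuous_functional_ker g : continuous_functional g ->
  exists m, forall x, p m x = 0 -> g x = 0.
Proof.
move=> g_cont.
have [m mP] := continuous_seminorm_ker X_frechet (seminorm_scalar g) g_cont.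
by exists m => x /mP/modulus_eq0.
Qed.

Lemma continuous_dominated_functional (q : X -> R) g :
  seminorm q -> continuous q -> (forall x, modulus (g x) <= q x) ->
  continuous_functional g.
Proof.
move=> q_semi q_cont gq x; apply/cvgrPdist_lt => e e0.
have : nbhs (0 : X) [set y | q y < e].
  have := q_cont 0; rewrite /continuous_at (seminorm0 q_semi).
  by move/cvgr_lt; exact.
have [_ _ _ p_top _] := X_frechet => /p_top[n [d [d0 dP]]].
apply/p_top; exists n, d; split=> // y yx /=.
apply: le_lt_trans (seminorm_dist (seminorm_scalar g) _ _) _.
apply: le_lt_trans (gq _) _; rewrite -(seminormN q_semi) opprB.
by apply: dP => j jn; rewrite subr0; exact: yx.
Qed.

Lemma closed_zeros (s : X -> R) : continuous s -> closed [set x | s x = 0].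
Proof.
move=> s_cont.
exact: ((continuous_closedP s).1 s_cont _ (@closed_eq _ 0)).
Qed.

Lemma closed_functional_ker g : continuous_functional g ->
  closed [set x | g x = 0].
Proof.
move=> /closed_zeros; congr (closed _).
apply/seteqP; split=> x /=; first exact: modulus_eq0.
by move=> ->; exact: modulus0.
Qed.

Variable j0 : nat.
Hypothesis codim : forall j, (j0 <= j)%N ->
  finite_codim_in (ker (p j.+1)) (ker (p j)).

(** The invariant subspace omits n = 0 from the equations g (T^n x) = 0, so
    that the solution y with g y = 1 belongs to it and is visibly nonzero. *)
Lemma invariant_subspace_free_orbit g : continuous_functional g ->
  (forall n, exists x, p j0 x = 0 /\ leading (orbit_functional g) n x) ->
  exists M, nontrivial_invariant_subspace T M.
Proof.
move=> g_cont g_lead.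
pose M := [set x | forall n, orbit_functional g n.+1 x = 0].
have [|y yP] := prescribed_values X_frechet codim g_lead _ (fun n => (n == 0%N)%:R).
  by move=> n; apply/continuous_functional_ker/continuous_orbit_functional.
exists M; split.
- split; first by rewrite in_setE => n; rewrite linear0.
  move=> a x z; rewrite !in_setE => Mx Mz n.
  by rewrite linearD scalarZ Mx Mz mulr0 addr0.
- have -> : M = \bigcap_n [set x | orbit_functional g n.+1 x = 0].
    by apply/seteqP; split=> [x Mx n _|x Mx n]; [exact: Mx|exact: Mx].
  apply: closed_bigI => n _.
  by apply/closed_functional_ker/continuous_orbit_functional.
- move=> M0; have : M y by move=> n; rewrite yP.
  rewrite M0 => y0; have := yP 0%N; rewrite y0 linear0 => /eqP.
  by rewrite eq_sym oner_eq0.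
- move=> MT; have [x [_ [_ x1]]] := g_lead 1%N.
  have : M x by rewrite MT.
  by move/(_ 0%N); rewrite x1 => /eqP; rewrite oner_eq0.
- move=> _ [x Mx <-] n; exact: (Mx n.+1).
Qed.

(** The functionals G i play three roles: together they decide whether T maps
    a vector of ker (p j0) into ker (p j0); the values of each along an orbit
    inside ker (p j0) all vanish as soon as finitely many do; and G 0, which is
    nonzero at u, keeps the subspace proper. *)
Lemma invariant_subspace_bound_orbit r (G : nat -> {scalar X}) u :
  without_continuous_norm X ->
  (forall i, (i < r)%N -> continuous_functional (G i)) ->
  (forall x, p j0 x = 0 -> (forall i, (i < r)%N -> G i x = 0) ->
     p j0 (T x) = 0) ->
  (forall i, (i < r)%N -> exists n, forall x, p j0 x = 0 ->
     (forall l, (l < n)%N -> G i (iter l T x) = 0) -> G i (iter n T x) = 0) ->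
  (0 < r)%N -> G 0%N u != 0 ->
  exists M, nontrivial_invariant_subspace T M.
Proof.
move=> X_no_norm G_cont GT G_bound r0 Gu.
have [D [D0 DP]] : exists D, (0 < D)%N /\ forall i, (i < r)%N ->
    exists2 n, (n <= D)%N & forall x, p j0 x = 0 ->
      (forall l, (l < n)%N -> G i (iter l T x) = 0) -> G i (iter n T x) = 0.
  pose P i D := (0 < D)%N /\ exists2 n, (n <= D)%N & forall x, p j0 x = 0 ->
      (forall l, (l < n)%N -> G i (iter l T x) = 0) -> G i (iter n T x) = 0.
  have [| |D DP] := @bounded_uniform r P.
  - move=> i n m nm [n0 [l ln lP]]; split; first exact: leq_trans n0 nm.
    by exists l => //; exact: leq_trans ln nm.
  - move=> i /G_bound[n nP]; exists n.+1; split=> //.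
    by exists n => //.
  by exists D; split=> [|i ir]; [case: (DP 0%N r0)|case: (DP i ir)].
pose M := [set x | p j0 x = 0 /\
  forall i l, (i < r)%N -> (l < D)%N -> orbit_functional (G i) l x = 0].
have iter_ker x l : M x -> (l <= D)%N -> p j0 (iter l T x) = 0.
  move=> [x0 Mx]; elim: l => // l IH lD; apply: GT; first exact/IH/ltnW.
  by move=> i ir; rewrite -orbit_functionalE Mx.
exists M; split.
- split.
    rewrite in_setE; split=> [|i l _ _]; first exact: seminorm0.
    by rewrite linear0.
  move=> a x z; rewrite !in_setE => -[x0 Mx] [z0 Mz]; split.
    by apply: kerD => //; exact: kerZ.
  by move=> i l ir lD; rewrite linearD scalarZ Mx // Mz // mulr0 addr0.
- have -> : M = [set x | p j0 x = 0] `&` \bigcap_(i in [set i | (i < r)%N])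
      \bigcap_(l in [set l | (l < D)%N]) [set x | orbit_functional (G i) l x = 0].
    apply/seteqP; split=> x [x0 Mx]; split=> // i.
      by move=> ir l lD; exact: Mx.
    by move=> l ir lD; exact: Mx i ir l lD.
  apply: closedI; first exact/closed_zeros/(continuous_seminorm X_frechet).
  apply: closed_bigI => i ir; apply: closed_bigI => l _.
  exact/closed_functional_ker/continuous_orbit_functional/G_cont.
- have [m mP] : exists m, forall i, (i < r)%N -> forall l, (l < D)%N ->
      forall x, p m x = 0 -> orbit_functional (G i) l x = 0.
    apply: (@bounded_uniform r (fun i m => forall l, (l < D)%N ->
        forall x, p m x = 0 -> orbit_functional (G i) l x = 0)).
      move=> i n m nm nP l lD x /(ker_antimono X_frechet nm); exact: nP.
    move=> i ir; apply: (@bounded_uniform D (fun l m =>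
        forall x, p m x = 0 -> orbit_functional (G i) l x = 0)).
      move=> l n m nm nP x /(ker_antimono X_frechet nm); exact: nP.
    move=> l lD; apply: continuous_functional_ker.
    exact/continuous_orbit_functional/G_cont.
  move=> M0; apply: X_no_norm; exists (p (maxn m j0)); split; last first.
    exact: continuous_seminorm.
  split=> // x x0; suff : M x by rewrite M0.
  split; first exact: (ker_antimono X_frechet (leq_maxr m j0) x0).
  move=> i l ir lD; apply: mP => //.
  exact: (ker_antimono X_frechet (leq_maxl m j0) x0).
- move=> MT; have : M u by rewrite MT.
  by case=> _ /(_ 0%N 0%N r0 D0) /= /eqP; apply/negP.
- move=> _ [x Mx <-]; split; first by have := iter_ker x 1%N Mx D0.
  move=> i l ir lD; rewrite orbit_functionalE -iterSr.
  have [lD1|] := ltnP l.+1 D.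
    by rewrite -orbit_functionalE; exact: (Mx.2).
  move=> Dl; have -> : l.+1 = D by apply/eqP; rewrite eqn_leq lD.
  (* T^(D - n) x still lies in ker (p j0), and its first n values vanish *)
  have [n nD nP] := DP i ir; rewrite -(subnKC nD) iterD.
  apply: nP => [|s sn]; first by apply: iter_ker => //; exact: leq_subr.
  rewrite -iterD -orbit_functionalE; apply: Mx.2 => //.
  by rewrite -[ltnRHS](subnKC nD) ltn_add2r.
Qed.

End Operator.

Theorem theorem2p1 (R : realType) (k : scalar_kind)
    (X : topologicalLmodType (scalars R k)) (p : nat -> X -> R)
    (X_frechet : frechet p)
    (X_no_norm : without_continuous_norm X)
    (codim : exists j0 : nat, forall j : nat, (j0 <= j)%N ->
       finite_codim_in (ker (p j.+1)) (ker (p j))) :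
  invariant_subspace_property X.
Proof.
move=> T T_cont; have [j0 {}codim] := codim.
have p_semi j : seminorm (p j) by case: X_frechet.
pose q := p j0 \o T.
have q_semi : seminorm q by exact: seminorm_comp.
have q_cont : continuous q.
  by move=> x; exact: (continuous_comp (T_cont x) (@continuous_seminorm _ _ _ _ X_frechet j0 _)).
have [m mP] := continuous_seminorm_ker X_frechet q_semi q_cont.
have [r [g [gq gP]]] : exists r (g : nat -> {scalar X}),
    (forall i x, (i < r)%N -> modulus (g i x) <= q x) /\
    forall x, ker (p j0) x -> (forall i, (i < r)%N -> g i x = 0) -> q x = 0.
  have : exists r (g : nat -> {scalar X}),
      (forall i x, (i < r)%N -> modulus (g i x) <= q x) /\
      forall x, ker (p (m + j0)%N) x ->
        (forall i, (i < r)%N -> g i x = 0) -> q x = 0.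
    exists 0%N, (fun=> \0); split=> // x x0 _; apply: mP.
    exact: (ker_antimono X_frechet (leq_addr j0 m) x0).
  elim: m {mP} => // n IH h; apply: IH; apply: finite_separation h => //.
  exact/codim/leq_addl.
have [u [j pu]] : exists u j, p j u != 0.
  apply: contrapT => p0; apply: X_no_norm; exists (p 0%N); split.
    split=> // x _; have [_ _ p_sep _ _] := X_frechet; apply: p_sep => j.
    by apply/eqP/contraT => pjx; case: p0; exists x, j.
  exact: continuous_seminorm.
have [f [fp fu]] := Hahn_Banach_seminorm u (p_semi j).
pose G i := if i is l.+1 then g l else f.
have G_cont i : (i < r.+1)%N -> continuous_functional (G i).
  case: i => [_|i ir].
    exact: (continuous_dominated_functional X_frechet (p_semi j)
      (@continuous_seminorm _ _ _ _ X_frechet j) fp).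
  apply: (continuous_dominated_functional X_frechet q_semi q_cont) => x.
  exact: gq.
have [[i [ir iP]]|bound] := pselect (exists i, (i < r.+1)%N /\
    forall n, exists x, p j0 x = 0 /\ leading (orbit_functional T (G i)) n x).
  exact: (invariant_subspace_free_orbit X_frechet T_cont codim (G_cont i ir)).
apply: (@invariant_subspace_bound_orbit _ _ _ _ X_frechet T T_cont j0 r.+1 G u) => //.
- move=> x x0 Gx; apply: gP => // i ir; exact: (Gx i.+1).
- move=> i ir; apply: contrapT => free; apply: bound; exists i; split=> // n.
  apply: contrapT => no_x; apply: free; exists n => x x0 low.
  apply/eqP/contraT => xn; case: no_x.
  exists ((G i (iter n T x))^-1 *: x); split; first exact: kerZ.
  split=> [l ln|]; rewrite scalarZ orbit_functionalE; first by rewrite (low l) // mulr0.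
  by rewrite mulVf.
- by apply: contra pu => /eqP fu0; rewrite -fu fu0 modulus0.
Qed.
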